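(* Let $(\mathfrak{h},[\cdot,\cdot]_{\mathfrak{h}},B_{\mathfrak{h}})$ be a quadratic Lie algebra over $\mathbb{F}$, let $\mathfrak{a}$ be a finite-dimensional vector space, and let $(\mathfrak{G},[\cdot,\cdot]_{\mathfrak{G}},B_{\mathfrak{G}})$, $\mathfrak{G}=\mathfrak{a}\oplus\mathfrak{h}\oplus\mathfrak{a}^{*}$, be a double central extension of $(\mathfrak{h},[\cdot,\cdot]_{\mathfrak{h}},B_{\mathfrak{h}})$ by $\mathfrak{a}$, with data $(\phi,\Psi,\omega)$. Let $\mathfrak{g}=\mathfrak{a}\oplus\mathfrak{h}$ be the Lie algebra with bracket $[a,b]_{\mathfrak{g}}=\Psi(a,b)$, $[a,x]_{\mathfrak{g}}=\phi(a)(x)$, $[x,y]_{\mathfrak{g}}=[x,y]_{\mathfrak{h}}$ for $a,b\in\mathfrak{a}$ and $x,y\in\mathfrak{h}$. Then $(\mathfrak{g},[\cdot,\cdot]_{\mathfrak{g}})$ admits an invariant metric if and only if there exists a linear map $L:\mathfrak{G}\to\mathfrak{G}$ such that: (i) $\operatorname{Ker}L=\mathfrak{a}^{*}$; (ii) $L|_{\mathfrak{g}}$ is injective; (iii) $L\in\Gamma_{B_{\mathfrak{G}}}(\mathfrak{G})$, i.e. $L([x,y]_{\mathfrak{G}})=[L(x),y]_{\mathfrak{G}}$ and $B_{\mathfrak{G}}(L(x),y)=B_{\mathfrak{G}}(x,L(y))$ for all $x,y\in\mathfrak{G}$.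
   Context: All Lie algebras are finite-dimensional over an algebraically closed field $\mathbb{F}$ of characteristic zero. An invariant metric on a Lie algebra $\mathfrak{g}$ is a non-degenerate symmetric bilinear form $B_{\mathfrak{g}}$ with $B_{\mathfrak{g}}(x,[y,z]_{\mathfrak{g}})=B_{\mathfrak{g}}([x,y]_{\mathfrak{g}},z)$ for all $x,y,z$; a quadratic Lie algebra is a Lie algebra with an invariant metric. Double central extension. Let $(\mathfrak{h},[\cdot,\cdot]_{\mathfrak{h}},B_{\mathfrak{h}})$ be a quadratic Lie algebra and $\mathfrak{a}$ a finite-dimensional vector space. Suppose given a linear map $\phi$ from $\mathfrak{a}$ to the space of $B_{\mathfrak{h}}$-skew-symmetric derivations of $\mathfrak{h}$, and skew-symmetric bilinear maps $\Psi:\mathfrak{a}\times\mathfrak{a}\to\mathfrak{h}$ and $\omega:\mathfrak{a}\times\mathfrak{a}\to\mathfrak{a}^{*}$. Define $\Phi:\mathfrak{h}\times\mathfrak{h}\to\mathfrak{a}^*$ by $\Phi(x,y)(a)=B_{\mathfrak{h}}(\phi(a)(x),y)$ and $\chi:\mathfrak{a}\times\mathfrak{h}\to\mathfrak{a}^*$ by $\chi(a,x)(b)=-B_{\mathfrak{h}}(\Psi(a,b),x)$. Assume that for all $a,b,c\in\mathfrak{a}$: $\phi(a)\phi(b)-\phi(b)\phi(a)=\operatorname{ad}_{\mathfrak{h}}(\Psi(a,b))$; $\phi(a)(\Psi(b,c))+\phi(b)(\Psi(c,a))+\phi(c)(\Psi(a,b))=0$; $\chi(a,\Psi(b,c))+\chi(b,\Psi(c,a))+\chi(c,\Psi(a,b))=0$;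 $\omega(a,b)(c)=\omega(b,c)(a)$. The double central extension of $\mathfrak{h}$ by $\mathfrak{a}$ is the quadratic Lie algebra $\mathfrak{G}=\mathfrak{a}\oplus\mathfrak{h}\oplus\mathfrak{a}^{*}$ with bracket $[a,b]_{\mathfrak{G}}=\Psi(a,b)+\omega(a,b)$, $[a,x]_{\mathfrak{G}}=\phi(a)(x)+\chi(a,x)$, $[x,y]_{\mathfrak{G}}=[x,y]_{\mathfrak{h}}+\Phi(x,y)$, and $[\alpha,\cdot]_{\mathfrak{G}}=0$, for $a,b\in\mathfrak{a}$, $x,y\in\mathfrak{h}$, $\alpha\in\mathfrak{a}^*$, and invariant metric $B_{\mathfrak{G}}(a+x+\alpha,b+y+\beta)=B_{\mathfrak{h}}(x,y)+\beta(a)+\alpha(b)$. (These conditions ensure that the brackets on $\mathfrak{G}$ and on $\mathfrak{a}\oplus\mathfrak{h}$ are Lie brackets.) *)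

(* Defs.v *)
From HB Require Import structures.
From mathcomp Require Import all_boot all_order all_algebra.
From mathcomp Require Import ring.

Set Implicit Arguments.
Unset Strict Implicit.
Unset Printing Implicit Defensive.

Import GRing.Theory.
Local Open Scope ring_scope.

(* Skew-symmetry is equivalent to [x, x] = 0 when the characteristic is not 2;
   only fields of characteristic zero matter here. *)
Record lie_bracket (F : fieldType) (V : vectType F) := LieBracket {
  lie_fun :> {bilinear V -> V -> V};
  lie_skew : forall x y, lie_fun x y = - lie_fun y x;
  lie_jacobi : forall x y z,
    lie_fun x (lie_fun y z) + lie_fun y (lie_fun z x) +
    lie_fun z (lie_fun x y) = 0
}.

Definition invariant_metric (F : fieldType) (V : vectType F)
    (br : lie_bracket V) (B : {symmetric V}) : Prop :=
  nondegenerate B /\ forall x y z, B x (br y z) = B (br x y) z.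

Record quadratic_lie (F : fieldType) (V : vectType F) := QuadraticLie {
  quad_bracket :> lie_bracket V;
  quad_metric : {symmetric V};
  quad_metricP : invariant_metric quad_bracket quad_metric
}.

(* The B-self-adjoint part of the centroid, for B the metric of q. *)
Definition metric_centroid (F : fieldType) (V : vectType F)
    (q : quadratic_lie V) (L : 'End(V)) : Prop :=
  (forall x y, L (q x y) = q (L x) y) /\
  (forall x y, quad_metric q (L x) y = quad_metric q x (L y)).

Section DoubleCentralExtensionData.
Variables (F : fieldType) (h a : vectType F).

Section Cocycles.
Variable B : {symmetric h}.

Definition Phi_map (phi : 'Hom(a, 'End(h))) (x y : h) : 'Hom(a, F^o) :=
  linfun (fun c : a => B (phi c x) y : F^o).

Definition chi_map (Psi : {bilinear a -> a -> h}) (b : a) (x : h) :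
    'Hom(a, F^o) :=
  linfun (fun c : a => - B (Psi b c) x : F^o).

(* linfun f agrees with f only if f is linear; these two lemmas check it. *)
Lemma Phi_mapE phi x y c : Phi_map phi x y c = B (phi c x) y.
Proof.
have lin : linear (fun c : a => B (phi c x) y : F^o).
  by move=> k u v; rewrite linearP add_lfunE scale_lfunE linearPl.
pose f : {linear a -> F^o} := HB.pack (fun c : a => B (phi c x) y : F^o)
  (GRing.isLinear.Build F a F^o _ (fun c : a => B (phi c x) y : F^o) lin).
exact: (lfunE f c).
Qed.

Lemma chi_mapE Psi b x c : chi_map Psi b x c = - B (Psi b c) x.
Proof.
have lin : linear (fun c : a => - B (Psi b c) x : F^o).
  move=> k u v; rewrite linearPr linearPl opprD.
  by rewrite -[RHS]/(k * - B (Psi b u) x - B (Psi b v) x) mulrN.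
pose f : {linear a -> F^o} := HB.pack (fun c : a => - B (Psi b c) x : F^o)
  (GRing.isLinear.Build F a F^o _ (fun c : a => - B (Psi b c) x : F^o) lin).
exact: (lfunE f c).
Qed.

End Cocycles.

Record dce_data (q : quadratic_lie h) := DceData {
  dce_phi : 'Hom(a, 'End(h));
  dce_Psi : {bilinear a -> a -> h};
  dce_omega : {bilinear a -> a -> 'Hom(a, F^o)};
  dce_phi_der : forall b x y,
    dce_phi b (q x y) = q (dce_phi b x) y + q x (dce_phi b y);
  dce_phi_skew : forall b x y,
    quad_metric q (dce_phi b x) y = - quad_metric q x (dce_phi b y);
  dce_Psi_skew : forall b c, dce_Psi b c = - dce_Psi c b;
  dce_omega_skew : forall b c, dce_omega b c = - dce_omega c b;
  dce_phi_comm : forall b c x,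
    dce_phi b (dce_phi c x) - dce_phi c (dce_phi b x) = q (dce_Psi b c) x;
  dce_phi_Psi : forall b c d,
    dce_phi b (dce_Psi c d) + dce_phi c (dce_Psi d b) +
    dce_phi d (dce_Psi b c) = 0;
  dce_chi_Psi : forall b c d,
    chi_map (quad_metric q) dce_Psi b (dce_Psi c d) +
    chi_map (quad_metric q) dce_Psi c (dce_Psi d b) +
    chi_map (quad_metric q) dce_Psi d (dce_Psi b c) = 0;
  dce_omega_cyclic : forall b c d, dce_omega b c d = dce_omega c d b
}.

End DoubleCentralExtensionData.

Section DoubleCentralExtension.
Variables (F : fieldType) (h a : vectType F) (q : quadratic_lie h).
Variable d : dce_data a q.

Local Notation B := (quad_metric q).
Local Notation phi := (dce_phi d).
Local Notation Psi := (dce_Psi d).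
Local Notation omega := (dce_omega d).
Local Notation Phi := (Phi_map B phi).
Local Notation chi := (chi_map B Psi).

Local Notation g := (a * h)%type.
Local Notation G := (a * h * 'Hom(a, F^o))%type.

(* (b, x) : g stands for b + x; the term - phi v.1 u.2 is [x, c] = - [c, x]. *)
Definition ext_br (u v : g) : g :=
  (0, Psi u.1 v.1 + phi u.1 v.2 - phi v.1 u.2 + q u.2 v.2).

(* (u, alpha) : G stands for u + alpha, with u in a + h. *)
Definition dce_br (u v : G) : G :=
  (ext_br u.1 v.1,
   omega u.1.1 v.1.1 + chi u.1.1 v.1.2 - chi v.1.1 u.1.2 + Phi u.1.2 v.1.2).

Definition dce_B (u v : G) : F :=
  B u.1.2 v.1.2 + v.2 u.1.1 + u.2 v.1.1.

Lemma nondegP (V : vectType F) (b : {symmetric V}) :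
  nondegenerate b <-> forall x, (forall y, b x y = 0) -> x = 0.
Proof.
split=> [/eqP nd x x0 | nd].
  by apply/eqP; rewrite -memv0 -nd; apply/mem_orthovP => y _; exact: x0.
apply/eqP/vspaceP => x; rewrite memv0; apply/mem_orthovP/eqP => [x0 | -> y _].
  by apply: nd => y; apply: x0; rewrite memvf.
exact: linear0l.
Qed.

Lemma metric_inj (x y : h) : B x =1 B y -> x = y.
Proof.
move=> e; apply/eqP; rewrite -subr_eq0; apply/eqP.
have [nd _] := quad_metricP q; apply: (proj1 (nondegP B) nd) => z.
by rewrite linearBl /= e subrr.
Qed.

Lemma metric_inv x y z : B x (q y z) = B (q x y) z.
Proof. by have [_] := quad_metricP q; exact. Qed.

Lemma metric_sym x y : B x y = B y x.
Proof. by rewrite hermC expr0 mul1r. Qed.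

Definition lfunDE :=
  (add_lfunE, scale_lfunE, opp_lfunE, zero_lfunE, Phi_mapE, chi_mapE).

Lemma lin0l (b : {symmetric h}) z : b 0 z = 0.
Proof. exact: linear0l. Qed.
Lemma linDl (b : {symmetric h}) x y z : b (x + y) z = b x z + b y z.
Proof. exact: linearDl. Qed.
Lemma linNl (b : {symmetric h}) x z : b (- x) z = - b x z.
Proof. exact: linearNl. Qed.
Lemma linZl (b : {symmetric h}) k x z : b (k *: x) z = k * b x z.
Proof. exact: linearZl. Qed.
Lemma linDr (b : {symmetric h}) x y z : b z (x + y) = b z x + b z y.
Proof. exact: linearDr. Qed.
Lemma linNr (b : {symmetric h}) x z : b z (- x) = - b z x.
Proof. exact: linearNr. Qed.
Lemma linZr (b : {symmetric h}) k x z : b z (k *: x) = k * b z x.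
Proof. exact: linearZr. Qed.

Definition linB := (lin0l, linDl, linNl, linZl, linDr, linNr, linZr).

Section BilinearRules.
Variables (U V W : vectType F) (f : {bilinear U -> V -> W}).
Lemma bilDl x y z : f (x + y) z = f x z + f y z. Proof. exact: linearDl. Qed.
Lemma bilNl x z : f (- x) z = - f x z. Proof. exact: linearNl. Qed.
Lemma bilZl k x z : f (k *: x) z = k *: f x z. Proof. exact: linearZl_LR. Qed.
Lemma bilDr x y z : f z (x + y) = f z x + f z y. Proof. exact: linearDr. Qed.
Lemma bilNr x z : f z (- x) = - f z x. Proof. exact: linearNr. Qed.
Lemma bilZr k x z : f z (k *: x) = k *: f z x. Proof. exact: linearZr_LR. Qed.
Lemma bil0r z : f z 0 = 0. Proof. exact: linear0r. Qed.
Lemma bil0l z : f 0 z = 0. Proof. exact: linear0l. Qed.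
End BilinearRules.

Definition linbr := (bilDl, bilNl, bilZl, bilDr, bilNr, bilZr, bil0l, bil0r).

Lemma dualZE k (f : 'Hom(a, F^o)) c : (k *: f) c = k * f c.
Proof. exact: scale_lfunE. Qed.
Lemma dualDE (f f' : 'Hom(a, F^o)) c : (f + f') c = f c + f' c :> F.
Proof. by rewrite add_lfunE. Qed.
Lemma dualNE (f : 'Hom(a, F^o)) c : (- f) c = - f c :> F.
Proof. by rewrite opp_lfunE. Qed.
Definition dualE := (dualZE, dualDE, dualNE, Phi_mapE, chi_mapE).

Lemma phiDl b c x : phi (b + c) x = phi b x + phi c x.
Proof. by rewrite linearD add_lfunE. Qed.
Lemma phiZl k b x : phi (k *: b) x = k *: phi b x.
Proof. by rewrite linearZ scale_lfunE. Qed.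
Lemma phiDr b x y : phi b (x + y) = phi b x + phi b y.
Proof. exact: linearD. Qed.
Lemma phiNr b x : phi b (- x) = - phi b x.
Proof. exact: linearN. Qed.
Lemma phiZr k b x : phi b (k *: x) = k *: phi b x.
Proof. exact: linearZ. Qed.
Lemma phi0l x : phi 0 x = 0.
Proof. by rewrite linear0 zero_lfunE. Qed.
Definition phiE := (phi0l, phiDl, phiZl, phiDr, phiNr, phiZr).

Lemma ext_br_bilinear : bilinear_for *:%R *:%R ext_br.
Proof.
split=> w k u v; congr (_, _); rewrite /= ?scaler0 ?addr0 //;
  apply: metric_inj => z; rewrite !phiE !linbr !linB; ring.
Qed.

HB.instance Definition _ :=
  bilinear_isBilinear.Build F g g g *:%R *:%R ext_br ext_br_bilinear.

Lemma dce_br_bilinear : bilinear_for *:%R *:%R dce_br.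
Proof.
have [l r] := ext_br_bilinear.
split=> w k u v; congr (_, _); rewrite ?l ?r //=; apply/lfunP => z;
  rewrite !dualE ?phiE !linbr !dualE !linB; ring.
Qed.

HB.instance Definition _ :=
  bilinear_isBilinear.Build F G G G *:%R *:%R dce_br dce_br_bilinear.

Lemma dce_B_bilinear : bilinear_for *%R (idfun \; *%R) dce_B.
Proof.
have dualP (f : 'Hom(a, F^o)) k b c : f (k *: b + c) = k * f b + f c :> F.
  by rewrite linearD linearZ.
by split=> w k u v; rewrite /dce_B /= !dualE !linB dualP; ring.
Qed.

HB.instance Definition _ :=
  bilinear_isBilinear.Build F G G F *%R (idfun \; *%R) dce_B dce_B_bilinear.

Lemma dce_B_hermitian u v : dce_B u v = (-1) ^+ false * idfun (dce_B v u).
Proof. by rewrite /dce_B expr0 mul1r /= metric_sym addrAC. Qed.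

HB.instance Definition _ :=
  isHermitianSesquilinear.Build F G false idfun dce_B dce_B_hermitian.

Lemma ext_br_skew u v : ext_br u v = - ext_br v u.
Proof.
congr (_, _); rewrite /= ?oppr0 //.
by apply: metric_inj => z; rewrite (dce_Psi_skew d) (lie_skew q u.2) !linB; ring.
Qed.

Lemma ext_br_jacobi u v w :
  ext_br u (ext_br v w) + ext_br v (ext_br w u) + ext_br w (ext_br u v) = 0.
Proof.
case: u v w => [b x] [c y] [e z]; congr (_, _); rewrite /= ?addr0 //.
apply: metric_inj => t.
have E b' c' x' : q x' (Psi b' c') = phi c' (phi b' x') - phi b' (phi c' x').
  by rewrite lie_skew -(dce_phi_comm d) opprB.
have /(congr1 (B ^~ t)) P := dce_phi_Psi d b c e.
have /(congr1 (B ^~ t)) J := lie_jacobi q x y z.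
move: P J; rewrite /= !phiE !linbr !(dce_phi_der d) !E !linB.
have S b' x' y' : q x' (phi b' y') = - q (phi b' y') x' by exact: lie_skew.
rewrite !S !linB => P J.
by apply: etrans (etrans (congr2 +%R P J) (addr0 0)); ring.
Qed.

Definition ext_bracket : lie_bracket g :=
  LieBracket (lie_fun := ext_br) ext_br_skew ext_br_jacobi.

Lemma dce_br_skew u v : dce_br u v = - dce_br v u.
Proof.
congr (_, _); first exact: ext_br_skew.
apply/lfunP => z; rewrite /= (dce_omega_skew d) !dualE.
rewrite (dce_phi_skew d) (metric_sym u.1.2); ring.
Qed.

Lemma dce_br_jacobi u v w :
  dce_br u (dce_br v w) + dce_br v (dce_br w u) + dce_br w (dce_br u v) = 0.
Proof.
congr (_, _); first exact: ext_br_jacobi.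
case: u v w => [[b x] ?] [[c y] ?] [[e z] ?]; apply/lfunP => t /=.
rewrite zero_lfunE !linbr !dualE.
have := congr1 (fun f : 'Hom(a, F^o) => f t : F) (dce_chi_Psi d b c e).
rewrite /= zero_lfunE !dualE => C.
have skew b' x' y' : B x' (phi b' y') = - B (phi b' x') y'.
  by rewrite (dce_phi_skew d) opprK.
have H1 b' c' z' : B (phi t z') (Psi b' c') =
    B (Psi b' t) (phi c' z') - B (Psi c' t) (phi b' z').
  have /(congr1 (B ^~ z')) := dce_phi_Psi d b' c' t.
  rewrite (dce_Psi_skew d t) phiNr !linB !skew => P.
  by rewrite (metric_sym _ (Psi b' c')) skew -[LHS]add0r -P; ring.
have H2 e' x' y' : B (Psi e' t) (q x' y') =
    B (phi t y') (phi e' x') - B (phi t x') (phi e' y').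
  rewrite metric_inv -(dce_phi_comm d) !linB (metric_sym (phi t y')) skew.
  by rewrite (skew e' (phi t x')); ring.
have H3 : B (phi t z) (q x y) =
    - B (phi t x) (q y z) - B (phi t y) (q z x).
  rewrite (metric_sym _ (q x y)) skew (dce_phi_der d) !linB -!metric_inv.
  rewrite (metric_inv (phi t y)) (lie_skew q _ z) !linB.
  by rewrite (metric_sym x); ring.
rewrite !linbr !linB !H1 !H2 !H3.
by rewrite -[RHS]C; ring.
Qed.

Definition dce_bracket : lie_bracket G :=
  LieBracket (lie_fun := dce_br) dce_br_skew dce_br_jacobi.

Lemma dce_B_metric : invariant_metric dce_bracket dce_B.
Proof.
split=> [|[[b x] al] [[c y] be] [[e z] ga]]; last first.
  rewrite /dce_bracket /= /dce_B /= ?linear0 !dualE !linB.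
  rewrite metric_inv (dce_Psi_skew d e) (dce_Psi_skew d b c).
  rewrite (dce_omega_cyclic d b) !linB.
  by rewrite !(dce_phi_skew d _ x) (metric_sym x (Psi c e)); ring.
apply/nondegP => -[[b x] al] nd.
have al0 : al = 0.
  apply/lfunP => c; have := nd (c, 0, 0).
  by rewrite /= /dce_B /= linear0r !zero_lfunE !add0r.
have x0 : x = 0.
  apply: metric_inj => y; have := nd (0, y, 0).
  by rewrite /= /dce_B /= !linear0 !zero_lfunE !addr0 linear0l.
have b0 : b = 0.
  rewrite (coord_vbasis (memvf b)) big1 // => i _.
  have := nd (0, 0, linfun (coord (vbasis fullv) i : a -> F^o)).
  rewrite /= /dce_B /= !linear0r linear0 lfunE add0r addr0 /= => ->.
  by rewrite scale0r.
by rewrite al0 x0 b0.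
Qed.

Definition dce : quadratic_lie G := QuadraticLie dce_B_metric.

(* The subspace a^* of G = (a + h) + a^*. *)
Definition dual_part : {vspace G} :=
  limg (linfun (fun alpha : 'Hom(a, F^o) => (0, alpha) : G)).

Lemma dual_partP (u : G) : reflect (u.1 = 0) (u \in dual_part).
Proof.
have lin : linear (fun alpha : 'Hom(a, F^o) => (0, alpha) : G).
  by move=> k x y; congr (_, _); rewrite /= scaler0 addr0.
pose f : {linear 'Hom(a, F^o) -> G} := HB.pack
  (fun alpha : 'Hom(a, F^o) => (0, alpha) : G)
  (GRing.isLinear.Build F _ G _ (fun alpha : 'Hom(a, F^o) => (0, alpha) : G) lin).
apply: (iffP memv_imgP) => [[al _ ->]|u0]; first by rewrite (lfunE f).
by exists u.2; rewrite ?memvf // (lfunE f); case: u u0 => ? ? /= ->.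
Qed.

End DoubleCentralExtension.

(* Main.v *)
(** With [B_G] the metric of [G = g + a^*] and [p : G -> g] the projection, which
    is a morphism of Lie algebras, invariant metrics [B] on [g] correspond to
    maps [L] through [B_G (L x) y = B (p x) (p y)]: given [B], [L] exists since
    [B_G] is non-degenerate; given [L], self-adjointness and [L a^* = 0] make
    [B_G (L x) y] depend only on [p x] and [p y]. *)
Require Import Defs.
From HB Require Import structures.
From mathcomp Require Import all_boot all_order all_algebra.

Set Implicit Arguments.
Unset Strict Implicit.
Unset Printing Implicit Defensive.

Import GRing.Theory.
Local Open Scope ring_scope.

Lemma linear_lfun (F : fieldType) (U V : vectType F) (f : U -> V) :
  linear f -> exists g : 'Hom(U, V), forall x, g x = f x.
Proof.
move=> lin; pose f' : {linear U -> V} :=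
  HB.pack f (GRing.isLinear.Build F U V _ f lin).
by exists (linfun f') => x; rewrite lfunE.
Qed.

(** Currying: turns a bilinear form into a linear map to the dual space, where kernel and dimension
    arguments apply. *)
Lemma bilinear_lfun (F : fieldType) (U V : vectType F) (c : U -> V -> F) :
    (forall x, linear (c x : V -> F^o)) ->
    (forall y, linear (c^~ y : U -> F^o)) ->
  exists T : 'Hom(U, 'Hom(V, F^o)), forall x y, T x y = c x y.
Proof.
move=> cr cl.
pose T x : 'Hom(V, F^o) := linfun (c x : V -> F^o).
have TE x y : T x y = c x y.
  pose f : {linear V -> F^o} :=
    HB.pack (c x : V -> F^o) (GRing.isLinear.Build F V F^o _ _ (cr x)).
  exact: (lfunE f).
have [k u v | T' T'E] := @linear_lfun _ _ _ T _.
  by apply/lfunP => y; rewrite add_lfunE scale_lfunE !TE; exact: cl.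
by exists T' => x y; rewrite T'E TE.
Qed.

(** Curry [b] and [c] to [R] and [S], both from [V] to its dual. Non-degeneracy makes [R] injective,
    hence bijective by equality of dimensions, and [L] is [S] followed by the inverse of [R]. *)
Lemma nondegenerate_represent (F : fieldType) (V : vectType F)
    (b : {symmetric V}) (c : V -> V -> F) :
    nondegenerate b ->
    (forall x, linear (c x : V -> F^o)) ->
    (forall y, linear (c^~ y : V -> F^o)) ->
  exists L : 'End(V), forall x y, b (L x) y = c x y.
Proof.
move=> /nondegP nd cr cl.
have [S SE] := bilinear_lfun cr cl.
have [x k u v | y k u v | R RE] := @bilinear_lfun _ V V b _ _.
- exact: linearPr.
- exact: linearPl.
have kerR : lker R == 0%VS.
  rewrite -subv0; apply/subvP => x; rewrite memv_ker memv0 => /eqP Rx.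
  by apply/eqP/nd => y; rewrite -RE Rx zero_lfunE.
have imR : limg R = fullv.
  apply/eqP; rewrite eqEdim subvf limg_dim_eq; last first.
    by rewrite (eqP kerR) capv0.
  by rewrite !dimvf /dim /= muln1.
exists (R^-1 \o S)%VF => x y.
by rewrite -RE comp_lfunE limg_lfunVK ?imR ?memvf // SE.
Qed.

Lemma symmetricC (F : fieldType) (V : vectType F) (b : {symmetric V}) x y :
  b x y = b y x.
Proof. by rewrite hermC expr0 mul1r. Qed.

Lemma linear_symmetric (F : fieldType) (V : vectType F) (c : V -> V -> F) :
    (forall y, linear (c^~ y : V -> F^o)) ->
    (forall x y, c x y = c y x) ->
  exists b : {symmetric V}, forall x y, b x y = c x y.
Proof.
move=> cl cC.
have bil : bilinear_for *%R (idfun \; *%R) c.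
  by split=> w k u v; rewrite /= ?(cC w); exact: cl.
have herm u v : c u v = (-1) ^+ false * idfun (c v u).
  by rewrite expr0 mul1r cC.
pose b : {symmetric V} := HB.pack c
  (bilinear_isBilinear.Build F V V F *%R (idfun \; *%R) c bil)
  (isHermitianSesquilinear.Build F V false idfun c herm).
by exists b.
Qed.

Theorem proposition3p1 (F : closedFieldType) (charF : [pchar F] =i pred0)
    (h a : vectType F) (q : quadratic_lie h) (d : dce_data a q) :
  (exists B : {symmetric (a * h)%type}, invariant_metric (ext_bracket d) B)
  <->
  (exists L : 'End((a * h * 'Hom(a, F^o))%type),
    [/\ lker L = dual_part h a,
        injective (fun u : (a * h)%type => L (u, 0)) &
        metric_centroid (dce d) L]).
Proof.
have [BG_nd BG_inv] := quad_metricP (dce d).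
have BG_inj := proj1 (nondegP _) BG_nd.
set BG := quad_metric (dce d) in BG_nd BG_inv BG_inj *.
split=> [[B [/nondegP B_nd B_inv]] | [L [kerL injL [Lbr Lsym]]]].
  have [x k u v | y k u v | L LE] :=
    nondegenerate_represent (c := fun x y => B x.1 y.1) BG_nd _ _.
  - exact: linearPr.
  - exact: linearPl.
  (* Non-degeneracy of [B] bounds the kernel of [L]; both (i) and (ii) follow. *)
  have L0 x : L x = 0 -> x.1 = 0.
    by move=> Lx; apply: B_nd => y; rewrite -(LE x (y, 0)) Lx linear0l.
  exists L; split; last split=> x y.
  - apply/vspaceP => x; rewrite memv_ker; apply/eqP/dual_partP => [/L0 //|x0].
    by apply: BG_inj => y; rewrite LE x0 linear0l.
  - move=> u v /eqP; rewrite -subr_eq0 -linearB => /eqP /L0 /eqP.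
    by rewrite subr_eq0 => /eqP.
  (* Paired with [z], the two sides become [B [x.1, y.1] z.1] and, by invariance of [BG], [B x.1
     [y.1, z.1]]. *)
  - apply/eqP; rewrite -subr_eq0; apply/eqP/BG_inj => z.
    rewrite linearBl /= LE -BG_inv LE; apply/eqP; rewrite subr_eq0; apply/eqP.
    by symmetry; exact: B_inv.
  - by rewrite LE symmetricC LE symmetricC.
have L0 al : L (0, al) = 0.
  by apply/eqP; rewrite -memv_ker kerL; apply/dual_partP.
have [y k u v | x y | B BE] :=
  linear_symmetric (c := fun u v : a * h => BG (L (u, 0)) (v, 0)).
- have -> : (k *: u + v, 0) = k *: (u, 0) + (v, 0) :> a * h * 'Hom(a, F^o).
    by congr (_, _); rewrite /= scaler0 addr0.
  by rewrite linearP linearPl.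
- by rewrite symmetricC Lsym.
(* [L] kills the dual part, which removes [x.2]; self-adjointness moves [L] onto [y] and removes
   [y.2] likewise. *)
have LE x y : BG (L x) y = B x.1 y.1.
  have split0 (z : a * h * 'Hom(a, F^o)) : z = (z.1, 0) + (0, z.2).
    by apply: injective_projections; rewrite /= ?addr0 ?add0r.
  have Lp z : L z = L (z.1, 0) by rewrite {1}(split0 z) linearD /= L0 addr0.
  by rewrite BE (Lp x) [LHS]Lsym (Lp y) -Lsym.
exists B; split=> [|x y z].
  apply/nondegP => u u0.
  (* By [LE], a vector [u] in the radical of [B] has [L (u, 0)] orthogonal to all of [G], not only
     to [g]. *)
  have /BG_inj : forall y, BG (L (u, 0)) y = 0 by move=> y; rewrite LE u0.
  by rewrite -(L0 0) => /injL.
(* The brackets in [G] may have components in the dual part; [LE] discards them and leaves the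
   brackets of [g]. *)
have := BG_inv (L (x, 0)) (y, 0) (z, 0).
by rewrite -Lbr !LE.
Qed.
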